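(* Let $R$ be a Noetherian ring, $I$ an ideal of $R$, and $N \subseteq M$ finitely generated $R$-modules. Then $$\mathrm{Ass}_R(M/I^nN) \cap V(I) = \mathrm{Ass}_R(0:_M I) \cup \mathrm{Ass}_R(I^{n-1}N/I^nN) \quad \text{for all } n \gg 0.$$ In particular, $\mathcal{A}^M_N(I) \cap V(I) = \mathrm{Ass}_R(0:_M I) \cup \mathcal{B}_N(I)$.
   Context: Rings are commutative. $V(I) := \{\mathfrak{p}\in\mathrm{Spec}(R) : I\subseteq\mathfrak{p}\}$ and $(0:_M I) := \{x\in M : Ix=0\}$. It is known that $\mathrm{Ass}_R(M/I^nN)$ and $\mathrm{Ass}_R(I^{n-1}N/I^nN)$ are independent of $n$ for all sufficiently large $n$; their stable values are denoted $\mathcal{A}^M_N(I)$ and $\mathcal{B}_N(I)$, respectively. *)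

(* Defs.v *)
From HB Require Import structures.
From mathcomp Require Import all_boot all_algebra.
From mathcomp Require Import boolp classical_sets.

Set Implicit Arguments.
Unset Strict Implicit.
Unset Printing Implicit Defensive.
Import GRing.Theory.
Local Open Scope ring_scope.
Local Open Scope classical_set_scope.
Local Open Scope quotient_scope.

(* Submodules of [M] are the library's bundled [submodClosed M]; their carriers
   are boolean predicates, which classically is no restriction ([asbool]).
   Ideals of [R], possibly equal to [R], are the submodules of the regular
   module [R^o] (the library's [idealr] only covers proper ideals of nontrivial
   rings). *)
Notation ideal R := (submodClosed R^o).

Section SubmoduleType.
Variables (R : comPzRingType) (M : lmodType R) (N : submodClosed M).

Record submod_of : Type := SubmodOf {
  submod_val :> M;
  submod_valP : submod_val \in N }.

HB.instance Definition _ := [isSub for submod_val].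
HB.instance Definition _ := [Choice of submod_of by <:].
HB.instance Definition _ := [SubChoice_isSubLmodule of submod_of by <:].

End SubmoduleType.

Section QuotientModule.
Variables (R : comPzRingType) (M : lmodType R) (N : submodClosed M).

(* [submodClosed] does not inherit from [zmodClosed], which the library's
   additive quotient expects, because it is shared with semimodules. *)
Definition submod_pred : {pred M} := fun x => x \in N.

Lemma submod_pred_closed : zmod_closed submod_pred.
Proof. exact: GRing.submod_closedB (submodClosedP N). Qed.

HB.instance Definition _ := GRing.isZmodClosed.Build M submod_pred
  submod_pred_closed.

Definition quotmod : Type := Quotient.quot submod_pred.

HB.instance Definition _ := GRing.Zmodule.on quotmod.
HB.instance Definition _ := EqQuotient.on quotmod.

Definition quotmod_scale (a : R) (q : quotmod) : quotmod :=
  \pi_quotmod (a *: repr q).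

Lemma quotmod_piP (x y : M) :
  reflect (\pi_quotmod x = \pi_quotmod y) (x - y \in N).
Proof.
by rewrite -[x - y \in N]/(x - y \in submod_pred) Quotient.idealrBE; apply: eqP.
Qed.

Lemma quotmod_pi_scale (a : R) (x : M) :
  quotmod_scale a (\pi_quotmod x) = \pi_quotmod (a *: x).
Proof.
apply/quotmod_piP; rewrite -scalerBr rpredZ //.
by apply/quotmod_piP; rewrite reprK.
Qed.

Lemma quotmod_piD (x y : M) :
  \pi_quotmod (x + y) = \pi_quotmod x + \pi_quotmod y :> quotmod.
Proof. exact: (Quotient.pi_add submod_pred x y). Qed.

Lemma quotmod_scaleA (a b : R) (q : quotmod) :
  quotmod_scale a (quotmod_scale b q) = quotmod_scale (a * b) q.
Proof. by rewrite [X in quotmod_scale a X]/quotmod_scale quotmod_pi_scale scalerA. Qed.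

Lemma quotmod_scale1 : left_id 1 quotmod_scale.
Proof. by move=> q; rewrite -[q]reprK quotmod_pi_scale scale1r. Qed.

Lemma quotmod_scaleDr : right_distributive quotmod_scale +%R.
Proof.
move=> a q r; rewrite -[q]reprK -[r]reprK -quotmod_piD !quotmod_pi_scale.
by rewrite scalerDr quotmod_piD.
Qed.

Lemma quotmod_scaleDl (q : quotmod) :
  {morph quotmod_scale^~ q : a b / a + b}.
Proof.
by move=> a b; rewrite -[q]reprK !quotmod_pi_scale scalerDl quotmod_piD.
Qed.

HB.instance Definition _ := GRing.Zmodule_isLmodule.Build R quotmod
  quotmod_scaleA quotmod_scale1 quotmod_scaleDr quotmod_scaleDl.

End QuotientModule.

Section Subquotient.
Variables (R : comPzRingType) (M : lmodType R) (P L : submodClosed M).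

Definition restrict_submod : {pred submod_of P} := fun x => val x \in L.

Lemma restrict_submod_closed : submod_closed restrict_submod.
Proof.
have valE x : (x \in restrict_submod) = (val x \in L) by [].
split=> [|a x y]; rewrite !valE ?raddf0 ?rpred0 // => xL yL.
by rewrite linearP rpredD ?rpredZ.
Qed.

HB.instance Definition _ := GRing.isSubmodClosed.Build R (submod_of P)
  restrict_submod restrict_submod_closed.

(* [P / L], meaningful for [L] contained in [P] *)
Definition subquot : lmodType R := quotmod restrict_submod.

End Subquotient.

Section Span.
Variables (R : comPzRingType) (M : lmodType R) (S : set M).

Definition span_pred : {pred M} := fun x =>
  `[< exists (n : nat) (c : 'I_n -> R) (v : 'I_n -> M),
        (forall i, S (v i)) /\ x = \sum_i c i *: v i >].

Lemma span_closed : submod_closed span_pred.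
Proof.
split=> [|a x y].
  rewrite unfold_in; apply/asboolP.
  by exists 0, (fun=> 0), (fun=> 0); split=> [[]//|]; rewrite big_ord0.
rewrite !unfold_in => /asboolP[n [c [v [vS ->]]]] /asboolP[m [d [w [wS ->]]]].
apply/asboolP; exists (n + m)%N.
exists (fun k => match split k with inl i => a * c i | inr j => d j end).
exists (fun k => match split k with inl i => v i | inr j => w j end).
split=> [k|]; first by case: (split k).
rewrite big_split_ord scaler_sumr; congr (_ + _); apply: eq_bigr => i _.
  by rewrite (unsplitK (inl i)) scalerA.
by rewrite (unsplitK (inr i)).
Qed.

HB.instance Definition _ :=
  GRing.isSubmodClosed.Build R M span_pred span_closed.

Definition span : submodClosed M := span_pred.

End Span.

Definition fg_module (R : comPzRingType) (M : lmodType R) : Prop :=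
  exists s : seq M, forall x : M, x \in span [set` s].

Definition noetherian (R : comPzRingType) : Prop :=
  forall J : ideal R, fg_module (submod_of J).

Definition ideal_smul (R : comPzRingType) (M : lmodType R)
    (I : ideal R) (N : submodClosed M) : submodClosed M :=
  span [set y | exists a : R, exists x : M, [/\ a \in I, x \in N & y = a *: x]].

Fixpoint ideal_pow (R : comPzRingType) (I : ideal R) (n : nat) : ideal R :=
  if n is k.+1 then ideal_smul I (ideal_pow I k)
  else span [set: R^o].

Section Annihilated.
Variables (R : comPzRingType) (M : lmodType R) (I : ideal R).

Definition colon0_pred : {pred M} := fun x =>
  `[< forall a : R, a \in I -> a *: x = 0 >].

Lemma colon0_closed : submod_closed colon0_pred.
Proof.
split=> [|a x y].
  by rewrite unfold_in; apply/asboolP => b _; rewrite scaler0.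
rewrite !unfold_in => /asboolP hx /asboolP hy; apply/asboolP => b bI.
by rewrite scalerDr scalerA mulrC -scalerA hx // hy // scaler0 addr0.
Qed.

HB.instance Definition _ :=
  GRing.isSubmodClosed.Build R M colon0_pred colon0_closed.

Definition colon0 : submodClosed M := colon0_pred.

End Annihilated.

Arguments colon0 {R} M I.

(* Points of Spec(R) are represented by their underlying sets, so that equality
   of prime ideals is equality of sets. *)
Definition prime_ideal (R : comPzRingType) (p : set R) : Prop :=
  [/\ p 0, forall x y, p x -> p y -> p (x + y), forall a x, p x -> p (a * x),
      ~ p 1 & forall x y, p (x * y) -> p x \/ p y].

Definition Vset (R : comPzRingType) (I : ideal R) : set (set R) :=
  [set p | prime_ideal p /\ forall a : R, a \in I -> p a].

Definition ann (R : comPzRingType) (M : lmodType R) (x : M) : set R :=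
  [set a | a *: x = 0].

Definition Ass (R : comPzRingType) (M : lmodType R) : set (set R) :=
  [set p | prime_ideal p /\ exists x : M, p = ann x].

Definition stable_value (T : Type) (F : nat -> T) (A : T) : Prop :=
  exists n0 : nat, forall n : nat, (n0 <= n)%N -> F n = A.

Lemma stable_value_unique (T : Type) (F : nat -> T) (A B : T) :
  stable_value F A -> stable_value F B -> A = B.
Proof.
move=> [m hA] [n hB].
by rewrite -(hA (maxn m n)) ?leq_maxl // hB ?leq_maxr.
Qed.

(* M / I^n N and I^(n-1) N / I^n N; the latter is only meant for n > 0. *)
Definition quot_pow (R : comPzRingType) (M : lmodType R) (I : ideal R)
    (N : submodClosed M) (n : nat) : lmodType R :=
  quotmod (ideal_smul (ideal_pow I n) N).

Definition gr_pow (R : comPzRingType) (M : lmodType R) (I : ideal R)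
    (N : submodClosed M) (n : nat) : lmodType R :=
  subquot (ideal_smul (ideal_pow I n.-1) N) (ideal_smul (ideal_pow I n) N).

(* Main.v *)
From HB Require Import structures.
Require Import Defs.
From mathcomp Require Import all_boot all_algebra.
From mathcomp Require Import boolp classical_sets.
From mathcomp Require Import zify.
Set Implicit Arguments.
Unset Strict Implicit.
Unset Printing Implicit Defensive.
Import GRing.Theory.
Local Open Scope ring_scope.
Local Open Scope classical_set_scope.

(* A prime of Ass(M/I^nN) contains I exactly when it is associated to
   (I^nN :_M I) / I^nN.  By Artin-Rees, for large n this colon is
   (0 :_M I) + I^(n-1)N, and (0 :_M I) meets I^(n-1)N trivially; hence the quotient
   is the direct sum of (0 :_M I) and I^(n-1)N/I^nN.  Both consequences come from
   the finite generation of graded submodules of a Rees module, proved by a leading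
   coefficient argument carried out inside the module, without polynomials. *)

(** * Submodules as sets and ascending chains *)

Definition is_submod {R : comPzRingType} {V : lmodType R} (L : set V) : Prop :=
  L 0 /\ forall a x y, L x -> L y -> L (a *: x + y).

(** Noetherianity as a chain condition: in this form it passes to images and finite powers, and it
    stabilises chains of leading coefficients. *)
Definition acc {R : comPzRingType} (V : lmodType R) : Prop :=
  forall C : nat -> set V, (forall n, is_submod (C n)) ->
    (forall n, C n `<=` C n.+1) -> exists k, forall n, C n `<=` C k.

Section Submodules.
Variables (R : comPzRingType) (V : lmodType R).
Implicit Types (L : set V) (N : submodClosed V).

Lemma is_submodD {L} : is_submod L -> forall x y, L x -> L y -> L (x + y).
Proof. by move=> [_ h] x y hx hy; rewrite -[x]scale1r; apply: h. Qed.

Lemma is_submodZ {L} : is_submod L -> forall a x, L x -> L (a *: x).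
Proof. by move=> [h0 h] a x hx; rewrite -[_ *: _]addr0; apply: h. Qed.

Lemma is_submodB {L} : is_submod L -> forall x y, L x -> L y -> L (x - y).
Proof.
by move=> h x y hx hy; rewrite -scaleN1r; apply: is_submodD => //; apply: is_submodZ.
Qed.

Lemma is_submod_mem N : is_submod [set x | x \in N].
Proof. by split=> [|a x y /= hx hy] /=; rewrite ?rpred0 // rpredD ?rpredZ. Qed.

Lemma span_min (S L : set V) :
  is_submod L -> S `<=` L -> forall x, x \in Defs.span S -> L x.
Proof.
move=> hL SL x; rewrite unfold_in => /asboolP[n [c [v [vS ->]]]].
elim/big_ind: _ => [|y z|i _]; first by case: hL.
- exact: is_submodD.
- by apply: is_submodZ => //; apply: SL.
Qed.

Lemma mem_span (S : set V) x : S x -> x \in Defs.span S.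
Proof.
move=> Sx; rewrite unfold_in; apply/asboolP.
by exists 1%N, (fun=> 1), (fun=> x); split=> //; rewrite big_ord1 scale1r.
Qed.

Lemma homo_chain (C : nat -> set V) : (forall n, C n `<=` C n.+1) ->
  forall m n, (m <= n)%N -> C m `<=` C n.
Proof.
move=> hC m n /subnK <-; elim: (n - m)%N => [|d IH] //=.
by rewrite addSn => x /IH; apply: hC.
Qed.

Lemma is_submod_bigcup (C : nat -> set V) : (forall n, is_submod (C n)) ->
  (forall n, C n `<=` C n.+1) -> is_submod [set x | exists n, C n x].
Proof.
move=> hC inc; split=> [|a x y [m hx] [n hy]]; first by exists 0%N; case: (hC 0%N).
exists (maxn m n); have [_] := hC (maxn m n); apply.
  by apply: (homo_chain inc (leq_maxl m n)).
by apply: (homo_chain inc (leq_maxr m n)).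
Qed.

End Submodules.

Lemma is_submod_preim (R : comPzRingType) (U V : lmodType R)
    (f : {linear U -> V}) (L : set V) :
  is_submod L -> is_submod [set x | L (f x)].
Proof.
by move=> [h0 h]; split=> [|a x y hx hy] /=; rewrite ?linear0 // linearP; apply: h.
Qed.

(** The maximum of the finitely many thresholds for $j\le J$ serves. *)
Lemma uniform_bound (Q : nat -> nat -> Prop) (J : nat) :
  (forall j, exists k, forall n, (k <= n)%N -> Q j n) ->
  exists k, forall j n, (j <= J)%N -> (k <= n)%N -> Q j n.
Proof.
move=> h; elim: J => [|J [k hk]].
  by have [k hk] := h 0%N; exists k => j n; rewrite leqn0 => /eqP ->; apply: hk.
have [k' hk'] := h J.+1; exists (maxn k k') => j n.
rewrite leq_eqVlt ltnS geq_max => /orP[/eqP ->|jJ] /andP[h1 h2]; first exact: hk'.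
exact: hk.
Qed.

(** * Ascending chains in finitely generated modules over Noetherian rings *)

Section Chains.
Variable R : comPzRingType.

Lemma acc_surj (U V : lmodType R) (f : {linear U -> V}) :
  (forall y, exists x, f x = y) -> acc U -> acc V.
Proof.
move=> surj accU C subC incC.
have [||k hk] := accU (fun n => [set x | C n (f x)]).
- by move=> n; apply: is_submod_preim.
- by move=> n x /incC.
by exists k => n y; have [x <-] := surj y; apply: hk.
Qed.

(* Compares the leading entries of the tuples in the chain, position by position. *)
Lemma acc_ffun (V : lmodType R) (r : nat) : acc V -> acc {ffun 'I_r -> V}.
Proof.
move=> accV C subC incC.
pose D (j n : nat) : set V := [set v | exists f, [/\ C n f,
   forall i : 'I_r, (i < j)%N -> f i = 0 & forall i : 'I_r, i = j :> nat -> f i = v]].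
have stab j : exists k, forall m, (k <= m)%N -> forall n, D j n `<=` D j m.
  have incD n : D j n `<=` D j n.+1.
    by move=> v [f [/incC hf h0 h1]]; exists f.
  have [||k hk] := accV (D j); last first.
  - by exists k => m km n v /hk; apply: (homo_chain incD km).
  - by [].
  move=> n; have [C0 Cl] := subC n; split.
    by exists 0; split=> // i _; rewrite ffunE.
  move=> a x y [f [Cf f0 fx]] [g [Cg g0 gy]]; exists (a *: f + g); split.
  - exact: Cl.
  - by move=> i ij; rewrite !ffunE f0 // g0 // scaler0 addr0.
  - by move=> i ij; rewrite !ffunE (fx _ ij) (gy _ ij).
have [k hk] := uniform_bound r stab.
exists k => n f Cnf.
(* Here [d] counts the trailing positions of [f'] that may still be nonzero; each round subtracts a
   tuple of [C k] with the same leading entry. *)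
suff main d f' : (d <= r)%N -> C (maxn n k) f' ->
    (forall i : 'I_r, (i < r - d)%N -> f' i = 0) -> C k f'.
  apply: (main r) => //; first exact: (homo_chain incC (leq_maxl n k)).
  by move=> i; rewrite subnn.
elim: d f' => [|d IH] f' dr Cf' f'0.
  suff -> : f' = 0 by case: (subC k).
  by apply/ffunP => i; rewrite ffunE f'0 // subn0.
pose j := Ordinal (rev_ord_proof (Ordinal dr)).
have [|g [Cg g0 gj]] := hk (r - d.+1)%N k (leq_subr _ _) (leqnn _) (maxn n k) (f' j).
  by exists f'; split=> // i ij; congr (f' _); apply: val_inj.
rewrite -[f'](subrK g); apply: is_submodD => //; apply: IH; first exact: ltnW.
  apply: is_submodB => //; exact: (homo_chain incC (leq_maxr n k)).
move=> i id; rewrite !ffunE.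
have [ij|ij] := ltnP i (r - d.+1); first by rewrite f'0 // g0 // subrr.
have e : i = (r - d.+1)%N :> nat by lia.
by rewrite (gj i e) (_ : i = j) ?subrr //; apply: val_inj.
Qed.

(** Pulls the generators out of the subtype and turns generation into an induction principle on the
    elements of [J]. *)
Lemma ideal_generators (J : ideal R) : noetherian R ->
  exists s : seq R, {subset s <= J} /\
    forall L : set R^o, is_submod L -> (forall a, a \in s -> L a) ->
      forall a, a \in J -> L a.
Proof.
move=> /(_ J)[s hs]; exists (map val s); split.
  by move=> _ /mapP[x _ ->]; exact: submod_valP.
move=> L hL sL a aJ.
have h := is_submod_preim (val : {linear submod_of J -> R^o}) hL.
apply: (span_min h _ (hs (SubmodOf aJ))) => x /= xs.
by apply: sL; apply: map_f.
Qed.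

(** The union of the chain is an ideal, and its finitely many generators all lie in one term. *)
Lemma noetherian_acc : noetherian R -> acc R^o.
Proof.
move=> noeth C subC incC.
have hU := is_submod_bigcup subC incC.
pose J : ideal R := Defs.span [set x | exists n, C n x].
have [s [sJ gen]] := ideal_generators J noeth.
have [k hk] : exists k, forall a, a \in s -> C k a.
  elim: s sJ {gen} => [|b s IH] sJ; first by exists 0%N.
  have [k hk] : exists k, forall a, a \in s -> C k a.
    by apply: IH => a ha; apply: sJ; rewrite inE ha orbT.
  have [m hm] : exists m, C m b.
    by apply: (span_min hU _ (sJ b (mem_head _ _))).
  exists (maxn k m) => a; rewrite inE => /orP[/eqP ->|/hk].
    exact: (homo_chain incC (leq_maxr k m)).
  exact: (homo_chain incC (leq_maxl k m)).
exists k => n x Cx; apply: (gen (C k)) => //.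
by apply: mem_span; exists n.
Qed.

(** [M] is the image of a finite power of [R] under the map sending coefficients to combinations of
    the generators. *)
Lemma fg_acc (M : lmodType R) : noetherian R -> fg_module M -> acc M.
Proof.
move=> noeth [s hs].
pose f (c : {ffun 'I_(size s) -> R^o}) : M := \sum_i c i *: s`_i.
have flin : linear f.
  move=> a c d; rewrite /f scaler_sumr -big_split; apply: eq_bigr => i _.
  by rewrite !ffunE scalerDl scalerA.
pose fL := GRing.isLinear.Build R _ _ _ f flin.
pose F : {linear {ffun 'I_(size s) -> R^o} -> M} := HB.pack f fL.
apply: (@acc_surj _ _ F); last exact/acc_ffun/noetherian_acc.
move=> y; apply: (span_min (L := [set y | exists x, F x = y]) _ _ (hs y)).
  split=> [|a x' y' [x <-] [z <-]]; first by exists 0; rewrite linear0.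
  by exists (a *: x + z); rewrite linearP.
move=> x /= xs; have ix : (index x s < size s)%N by rewrite index_mem.
exists [ffun i => (i == Ordinal ix)%:R]; rewrite /F /= /f.
rewrite (bigD1 (Ordinal ix)) //= ffunE eqxx scale1r nth_index // big1 ?addr0 //.
by move=> i /negbTE ne; rewrite ffunE ne scale0r.
Qed.

End Chains.

(** * Rees modules and the Artin-Rees lemma *)

Section Graded.
Variables (R : comPzRingType) (V : lmodType R).
Implicit Types (L N : set V) (s : seq R).

(** For a submodule [L] this is $s_1L+\dots+s_rL$; the recursion splits off one generator, as the
    inductions on [s] require. *)
Fixpoint mulsum s L : set V :=
  if s is a :: s' then [set z | exists x y, [/\ L x, mulsum s' L y & z = a *: x + y]]
  else [set 0].

(** For a submodule [N], the degree-$n$ component $(s)^nN$ of its Rees module. *)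
Fixpoint pows s N n : set V :=
  if n is m.+1 then mulsum s (pows s N m) else N.

Lemma is_submod0 : is_submod [set 0 : V].
Proof. by split=> [|a x y -> ->] //=; rewrite scaler0 addr0. Qed.

Lemma is_submod_mulsum s L : is_submod L -> is_submod (mulsum s L).
Proof.
move=> [L0 hL]; elim: s => [|b s [IH0 IH]] /=; first exact: is_submod0.
split=> [|a _ _ [x [y [Lx Ly ->]]] [x' [y' [Lx' Ly' ->]]]].
  by exists 0, 0; rewrite scaler0 addr0.
exists (a *: x + x'), (a *: y + y'); split; [exact: hL|exact: IH|].
by rewrite !scalerDr addrACA !scalerA mulrC.
Qed.

Lemma is_submod_pows s N n : is_submod N -> is_submod (pows s N n).
Proof. by move=> hN; elim: n => //= n; apply: is_submod_mulsum. Qed.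

Lemma mulsum_sub s L L' : is_submod L' ->
  (forall a x, a \in s -> L x -> L' (a *: x)) -> mulsum s L `<=` L'.
Proof.
move=> hL'; elim: s => [|b s IH] h /=; first by move=> _ ->; case: hL'.
move=> _ [x [y [Lx Ly ->]]]; apply: (is_submodD hL').
  by apply: h => //; rewrite mem_head.
by apply: IH Ly => a z ha; apply: h; rewrite inE ha orbT.
Qed.

Lemma mem_mulsum s L a x : is_submod L -> a \in s -> L x -> mulsum s L (a *: x).
Proof.
move=> hL; elim: s => //= b s IH; rewrite inE => /orP[/eqP ->|ha] Lx.
  by exists x, 0; rewrite addr0; split=> //; case: (is_submod_mulsum s hL).
by exists 0, (a *: x); rewrite scaler0 add0r; split; [case: hL|exact: IH|].
Qed.

Lemma mulsumS s L L' : L `<=` L' -> mulsum s L `<=` mulsum s L'.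
Proof.
move=> LL'; elim: s => //= b s IH _ [x [y [Lx Ly ->]]].
by exists x, y; split; [exact: LL'|exact: IH|].
Qed.

(* The elements of degree [n] in the Rees module of [b :: s] having degree less
   than [j] in [b]; only meaningful for [j <= n.+1]. *)
Fixpoint low b s N (j n : nat) : set V :=
  if j is j'.+1 then
    [set z | exists q y, [/\ pows s N (n - j') q, low b s N j' n y
                           & z = b ^+ j' *: q + y]]
  else [set 0].

Section Low.
Variables (b : R) (s : seq R) (N : set V).
Hypothesis subN : is_submod N.

Lemma is_submod_low j n : is_submod (low b s N j n).
Proof.
elim: j => [|j [IH0 IH]] /=; first exact: is_submod0.
have [Q0 hQ] := is_submod_pows s (n - j) subN.
split=> [|a _ _ [x [y [Lx Ly ->]]] [x' [y' [Lx' Ly' ->]]]].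
  by exists 0, 0; rewrite scaler0 addr0.
exists (a *: x + x'), (a *: y + y'); split; [exact: hQ|exact: IH|].
by rewrite !scalerDr addrACA !scalerA mulrC.
Qed.

Lemma low_succ j n : low b s N j n `<=` low b s N j.+1 n.
Proof.
move=> y hy; exists 0, y; rewrite scaler0 add0r; split=> //.
by case: (is_submod_pows s (n - j) subN).
Qed.

(** A factor from [s] raises only the degree in [s]. The bound on [j] keeps the truncated
    differences in [low] exact. *)
Lemma low_mulr a j n : a \in s -> (j <= n.+1)%N ->
  forall x, low b s N j n x -> low b s N j n.+1 (a *: x).
Proof.
move=> ha; elim: j => [|j IH] jn x /=; first by move=> ->; rewrite scaler0.
move=> [q [y [hq hy ->]]]; exists (a *: q), (a *: y); split.
- by rewrite subSn //=; apply: mem_mulsum => //; apply: is_submod_pows.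
- by apply: IH => //; apply: ltnW.
- by rewrite scalerDr !scalerA mulrC.
Qed.

Lemma low_mulb j n x : low b s N j n x -> low b s N j.+1 n.+1 (b *: x).
Proof.
elim: j x => [|j IH] x.
  by move=> ->; rewrite scaler0; case: (is_submod_low 1 n.+1).
move=> [q [y [hq hy ->]]]; exists q, (b *: y); split; first by rewrite subSS.
  exact: IH.
by rewrite scalerDr scalerA exprS.
Qed.

(** Expansion into terms $b^jq_j$ with $0\le j\le n$, by induction on $n$: a factor [b] raises the
    bound on the degree in [b], a factor from [s] keeps it. *)
Lemma pows_low n : pows (b :: s) N n `<=` low b s N n.+1 n.
Proof.
elim: n => [|n IH] x.
  by move=> Nx; exists x, 0; rewrite subnn expr0 scale1r addr0.
move=> [u [y [hu hy ->]]]; apply: is_submodD; first exact: is_submod_low.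
  by apply: low_mulb; apply: IH.
apply: low_succ; apply: mulsum_sub hy; first exact: is_submod_low.
by move=> a z ha hz; apply: low_mulr => //; apply: IH.
Qed.

(* Leading coefficients, with respect to [b], of the elements of degree [j] in [b]
   and [i] in [s]. *)
Definition lead (L : nat -> set V) (j i : nat) : set V :=
  [set q | pows s N i q /\
    exists2 y, low b s N j (i + j) y & L (i + j)%N (b ^+ j *: q + y)].

Variable L : nat -> set V.
Hypothesis subL : forall n, is_submod (L n).
Hypothesis mulL : forall n a x, a \in b :: s -> L n x -> L n.+1 (a *: x).

Lemma is_submod_lead j i : is_submod (lead L j i).
Proof.
have [Q0 hQ] := is_submod_pows s i subN.
have [l0 hl] := is_submod_low j (i + j).
have [L0 hL] := subL (i + j).
split=> [|a q r [hq [y hy Ly]] [hr [z hz Lz]]].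
  by split=> //; exists 0; rewrite // scaler0 addr0.
split; first exact: hQ.
exists (a *: y + z); first exact: hl.
suff -> : b ^+ j *: (a *: q + r) + (a *: y + z)
  = a *: (b ^+ j *: q + y) + (b ^+ j *: r + z) by apply: hL.
by rewrite !scalerDr addrACA !scalerA mulrC.
Qed.

Lemma lead_mul j i a q : a \in s -> lead L j i q -> lead L j i.+1 (a *: q).
Proof.
move=> ha [hq [y hy Ly]]; split.
  by apply: mem_mulsum => //; apply: is_submod_pows.
exists (a *: y).
  by apply: low_mulr => //; rewrite (leq_trans (leq_addl i j)).
have -> : b ^+ j *: (a *: q) + a *: y = a *: (b ^+ j *: q + y).
  by rewrite scalerDr !scalerA mulrC.
by apply: mulL => //; rewrite inE ha orbT.
Qed.

(** Multiplication by [b] raises the degree in [b] and keeps the leading coefficient. *)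
Lemma lead_succ j i : lead L j i `<=` lead L j.+1 i.
Proof.
move=> q [hq [y hy Ly]]; split=> //; exists (b *: y); rewrite addnS.
  exact: low_mulb.
have -> : b ^+ j.+1 *: q + b *: y = b *: (b ^+ j *: q + y).
  by rewrite scalerDr scalerA exprS.
by apply: mulL => //; rewrite mem_head.
Qed.

(** A combination of leading coefficients lifts to the same combination of the elements of [L] that
    they come from. *)
Lemma mulsum_lead j i q : mulsum s (lead L j i) q ->
  exists2 y, low b s N j (i + j).+1 y & mulsum s (L (i + j)%N) (b ^+ j *: q + y).
Proof.
pose X := [set q | exists2 y, low b s N j (i + j).+1 y &
  mulsum s (L (i + j)%N) (b ^+ j *: q + y)].
move=> hq; apply: (mulsum_sub (L' := X)) hq.
  have [l0 hl] := is_submod_low j (i + j).+1.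
  have [L0 hL] := is_submod_mulsum s (subL (i + j)).
  split=> [|a x x' [y hy Ly] [z hz Lz]].
    by exists 0; rewrite // scaler0 addr0.
  exists (a *: y + z); first exact: hl.
  suff -> : b ^+ j *: (a *: x + x') + (a *: y + z)
    = a *: (b ^+ j *: x + y) + (b ^+ j *: x' + z) by apply: hL.
  by rewrite !scalerDr addrACA !scalerA mulrC.
move=> a x ha [_ [y hy Ly]]; exists (a *: y).
  by apply: low_mulr => //; rewrite (leq_trans (leq_addl i j)).
have -> : b ^+ j *: (a *: x) + a *: y = a *: (b ^+ j *: x + y).
  by rewrite scalerDr !scalerA mulrC.
exact: mem_mulsum.
Qed.

End Low.

(* The Artin-Rees lemma for graded submodules [L] of the Rees module, by
   induction on the number of generators as in Hilbert's basis theorem. *)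
Lemma artin_rees s N (L : nat -> set V) : acc V -> is_submod N ->
  (forall n, is_submod (L n)) -> (forall n, L n `<=` pows s N n) ->
  (forall n a x, a \in s -> L n x -> L n.+1 (a *: x)) ->
  exists k, forall n, (k <= n)%N -> L n.+1 `<=` mulsum s (L n).
Proof.
move=> accV subN; elim: s L => [|b s IH] L subL LP mulL.
  (* Without generators, [pows [::] N n.+1] and [mulsum [::] (L n)] are both [[set 0]]. *)
  by exists 0%N => n _; apply: LP.
pose D := lead b s N L.
have subD j i : is_submod (D j i) by apply: is_submod_lead.
have incD i j : D j i `<=` D j.+1 i by apply: lead_succ.
have mulD j i a q : a \in s -> D j i q -> D j i.+1 (a *: q).
  by apply: lead_mul.
(* For fixed [j] the leading coefficients form a graded submodule of the Rees module of [s], so the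
   induction hypothesis applies. *)
have finD j : exists k, forall i, (k <= i)%N -> D j i.+1 `<=` mulsum s (D j i).
  by apply: IH => // [i q []|i a q] //; apply: mulD.
pose U i := [set q | exists j, D j i q].
have [|i|i a q ha [j hj]|kU hU] := IH U.
- by move=> i; apply: is_submod_bigcup.
- by move=> q [j []].
- by exists j; apply: mulD.
(* One [j0] serves every [i]: up to [kU] the chains stabilise by [accV], and beyond [kU] the set
   [U i] is generated from lower degree. *)
have [j0 hj0] : exists j0, forall i, U i `<=` D j0 i.
  have stab i : exists k, forall j, (k <= j)%N -> U i `<=` D j i.
    have [k hk] := accV (fun j => D j i) (subD ^~ i) (incD i).
    by exists k => j kj q [m /hk]; apply: (homo_chain (incD i)).
  have [j0 hj0] := uniform_bound kU stab; exists j0; elim=> [|i IHi].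
    exact: hj0.
  have [iU|Ui] := leqP i.+1 kU; first exact: hj0.
  move=> q /(hU i Ui) hq.
  by apply: mulsum_sub hq => // a x ha /IHi; apply: mulD.
have [K hK] := uniform_bound j0 finD.
(* For $n\ge K+j_0$, every $j\le j_0$ leaves degree $n-j\ge K$ in [s], where [hK] applies. *)
exists (K + j0)%N => n hn x Lx.
have sub_mulsum z : mulsum s (L n) z -> mulsum (b :: s) (L n) z.
  move=> hz; exists 0, z; rewrite scaler0 add0r; split=> //.
  by case: (subL n).
have mulLn z : mulsum (b :: s) (L n) z -> L n.+1 z.
  by apply: mulsum_sub => // a y; apply: mulL.
(* Induction on the bound [j] for the degree in [b]: the leading term is cancelled by an element of
   [mulsum (b :: s) (L n)]. *)
suff main j y : (j <= n.+2)%N -> L n.+1 y -> low b s N j n.+1 y ->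
    mulsum (b :: s) (L n) y.
  by apply: (main n.+2) => //; apply: pows_low => //; apply: LP.
have subM := is_submod_mulsum (b :: s) (subL n).
elim: j y => [|j IHj] y jn Ly; first by move=> ->; case: subM.
have step l z : mulsum (b :: s) (L n) l -> low b s N j n.+1 z -> y = l + z ->
    mulsum (b :: s) (L n) y.
  move=> hl hz e; rewrite e; apply: is_submodD => //; apply: IHj => //.
    exact: ltnW.
  have -> : z = y - l by rewrite e addrC addKr.
  by apply: is_submodB => //; apply: mulLn.
have subl := is_submod_low b s subN j n.+1.
move=> [q [z [hq hz e]]].
have lq : D j (n.+1 - j)%N q.
  by split=> //; rewrite subnK //; exists z; rewrite -?e.
(* Low degree in [b]: [q] is a combination over [s] of leading coefficients of elements of [L n],
   and this lifts. *)
have [jj|jj] := leqP j j0.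
  have jn' : (j <= n)%N by lia.
  have hKn : (K <= n - j)%N by lia.
  move: lq; rewrite subSn // => /(hK j _ jj hKn).
  move=> /(mulsum_lead subN subL)[y']; rewrite subnK // => hy' /sub_mulsum hl.
  apply: (step _ (z - y') hl); first exact: is_submodB.
  by rewrite e addrACA subrr addr0.
(* High degree in [b]: [q] is already a leading coefficient one power of [b] lower, so [b] times an
   element of [L n] cancels the term. *)
case: j {IHj hq} jj jn e hz subl lq step => // j jj jn e hz subl lq step.
have /hj0 lq0 : U (n.+1 - j.+1)%N q by exists j.+1.
have /(homo_chain (incD _) (m := j0) (n := j) jj) [_ [y' hy' Ly']] := lq0.
rewrite subSS subnK // in hy' Ly'.
apply: (step (b *: (b ^+ j *: q + y')) (z - b *: y')).
- by apply: mem_mulsum; rewrite ?mem_head.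
- by apply: is_submodB => //; apply: low_mulb.
by rewrite e scalerDr scalerA -exprS addrACA subrr addr0.
Qed.

End Graded.

(** The summands are chosen coordinatewise and collected into tuples. This places tuples with
    entries in $(s)^nN$ in the Rees module of $N^r$. *)
Lemma mulsum_ffun (R : comPzRingType) (V : lmodType R) (r : nat) (s : seq R)
    (L : set V) (f : {ffun 'I_r -> V}) :
  (forall i, mulsum s L (f i)) ->
  mulsum s [set g : {ffun 'I_r -> V} | forall i, L (g i)] f.
Proof.
move=> hf; elim: s f hf => [|b s IH] f hf /=.
  by apply/ffunP => i; rewrite ffunE; apply: hf.
have /fin_all_exists[g hg] i :
    exists w, [/\ L w.1, mulsum s L w.2 & f i = b *: w.1 + w.2].
  by have [x [y h]] := hf i; exists (x, y).
exists [ffun i => (g i).1], [ffun i => (g i).2]; split.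
- by move=> i; rewrite ffunE; case: (hg i).
- by apply: IH => i; rewrite ffunE; case: (hg i).
- by apply/ffunP => i; rewrite !ffunE; case: (hg i).
Qed.

(** * Consequences of Artin-Rees for $I^nN$ *)

Section ArtinRees.
Variables (R : comPzRingType) (I : ideal R) (M : lmodType R) (N : submodClosed M).

Let IN n : set M := [set x | x \in ideal_smul (ideal_pow I n) N].

Let subIN n : is_submod (IN n).
Proof. exact: is_submod_mem. Qed.

Lemma ideal_pow_smul_mul n a x : a \in I -> IN n x -> IN n.+1 (a *: x).
Proof.
move=> aI; apply: (span_min (L := [set x | IN n.+1 (a *: x)])).
  exact: (@is_submod_preim R M M (GRing.scale a : {linear M -> M}) _ (subIN n.+1)).
move=> _ [c [y [cI yN ->]]]; rewrite /= scalerA; apply: mem_span.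
exists (a * c), y; split=> //; apply: mem_span; by exists a, c.
Qed.

Lemma ideal_pow_smul_succ_sub n : IN n.+1 `<=` IN n.
Proof.
move=> x; apply: (span_min (subIN n)) => _ [c [y [cI yN ->]]].
apply: mem_span; exists c, y; split=> //.
apply: (span_min (is_submod_mem (ideal_pow I n))) cI => _ [a [d [_ dI ->]]].
exact: (is_submodZ (is_submod_mem (ideal_pow I n)) a dI).
Qed.

Variable s : seq R.
Hypothesis sI : {subset s <= I}.
Hypothesis genI : forall L : set R^o, is_submod L -> (forall a, a \in s -> L a) ->
  forall a, a \in I -> L a.

(** $I^{n+1}N$ is spanned by products $ady$ with $a\in I$, $d\in I^n$, $y\in N$. For fixed $d,y$ the
    good $a$ form an ideal, so $a$ may be taken in [s]. *)
Lemma ideal_pow_smul_mulsum n : IN n.+1 `<=` mulsum s (IN n).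
Proof.
have subS := is_submod_mulsum s (subIN n); have [S0 hS] := subS.
move=> x; apply: (span_min subS) => _ [c [y [cI yN ->]]].
pose X : set R^o := [set c | mulsum s (IN n) (c *: y)].
have subX : is_submod X.
  split=> [|a u v hu hv]; rewrite /X /= ?scale0r //.
  by rewrite scalerDl -scalerA; apply: hS.
apply: (span_min subX) cI => _ [a [d [aI dI ->]]].
pose Y : set R^o := [set a | mulsum s (IN n) ((a * d) *: y)].
apply: (genI (L := Y)) aI.
  split=> [|a' u v hu hv]; rewrite /Y /= ?mul0r ?scale0r //.
  by rewrite mulrDl scalerDl -mulrA -scalerA; apply: hS.
move=> e es; rewrite /Y /= -scalerA; apply: mem_mulsum => //.
by apply: mem_span; exists d, y.
Qed.

Lemma ideal_pow_smul_pows n : IN n `<=` pows s [set x | x \in N] n.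
Proof.
elim: n => [|n IH] x /=.
  apply: (span_min (is_submod_mem N)) => _ [c [y [_ yN ->]]].
  exact: rpredZ.
by move/ideal_pow_smul_mulsum; apply: mulsumS.
Qed.

(** The submodules $L_n=I^nN\cap(0:_MI)$ are killed by [s], so Artin-Rees forces $L_{n+1}=0$ for
    large $n$. *)
Lemma colon0_cap_eventually0 : acc M -> exists k, forall n, (k <= n)%N ->
  forall x, IN n x -> x \in colon0 M I -> x = 0.
Proof.
move=> accM; pose L n : set M := IN n `&` [set x | x \in colon0 M I].
have colonP x a : x \in colon0 M I -> a \in I -> a *: x = 0.
  by rewrite unfold_in => /asboolP; apply.
have [||n a x ha [hx hc]|k hk] := artin_rees (s := s) (L := L) accM (is_submod_mem N).
- move=> n; have [h0 h] := subIN n; have [c0 c] := is_submod_mem (colon0 M I).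
  split=> // a x y [hx cx] [hy cy]; split; [exact: h|exact: c].
- by move=> n x [/ideal_pow_smul_pows].
- split; first by apply: ideal_pow_smul_mul; rewrite ?sI.
  by rewrite colonP ?sI //=; apply: rpred0.
exists k.+1 => -[//|n] kn x hx cx.
have := hk n kn x (conj hx cx); apply: (mulsum_sub (L' := [set 0])).
  exact: is_submod0.
by move=> a y /sI aI [_ cy] /=; apply: colonP.
Qed.

(* Artin-Rees applied to the graph [x |-> (s_i x)_i] inside the power [M ^ (size s)]. *)
Lemma colon_eventually : acc M -> exists k, forall n, (k <= n)%N ->
  forall x, (forall a, a \in I -> IN n.+1 (a *: x)) ->
  exists2 y, IN n y & x - y \in colon0 M I.
Proof.
move=> accM; pose W := {ffun 'I_(size s) -> M}.
pose NW : set W := [set f | forall i, f i \in N].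
have subNW : is_submod NW.
  split=> [i|a f g hf hg i]; rewrite !ffunE ?rpred0 //.
  by rewrite rpredD ?rpredZ.
pose C n : set M := [set x | forall a, a \in I -> IN n (a *: x)].
pose phi (x : M) : W := [ffun i : 'I_(size s) => s`_i *: x].
have phiP a x y : phi (a *: x + y) = a *: phi x + phi y.
  by apply/ffunP => i; rewrite !ffunE scalerDr !scalerA mulrC.
have phi0 : phi 0 = 0 by apply/ffunP => i; rewrite !ffunE scaler0.
(* The kernel of [phi] is $(0:_MI)$, because [s] generates [I]. *)
have phi_eq0 x y : phi x = phi y -> x - y \in colon0 M I.
  move=> e; rewrite unfold_in; apply/asboolP.
  apply: (genI (L := [set a | a *: (x - y) = 0])).
    split=> [|a b c hb hc] /=; first by rewrite scale0r.
    by rewrite scalerDl -scalerA hb hc scaler0 addr0.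
  move=> a /(nthP 0)[i ilt <-] /=; move/ffunP/(_ (Ordinal ilt)): e.
  by rewrite !ffunE /= scalerBr => ->; rewrite subrr.
(* The images of the colons $(I^nN:_MI)$ lie in the Rees module of $N^r$, as each $s_ix$ lies in
   $I^nN$. *)
pose L n : set W := [set f | exists2 x, C n x & f = phi x].
have subC n : is_submod (C n).
  have [h0 h] := subIN n; split=> [a _|a x y hx hy b bI]; rewrite ?scaler0 //.
  by rewrite scalerDr scalerA mulrC -scalerA; apply: h; [apply: hx|apply: hy].
have pows_ffun n (f : W) : (forall i, pows s [set x | x \in N] n (f i)) -> pows s NW n f.
  elim: n f => [|n IH] f //= hf.
  by apply: mulsumS (mulsum_ffun hf) => g; apply: IH.
have [|||k hk] := artin_rees (s := s) (L := L) (@acc_ffun _ _ (size s) accM) subNW.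
- move=> n; have [C0 hC] := subC n; split; first by exists 0.
  by move=> a _ _ [x hx ->] [y hy ->]; exists (a *: x + y); rewrite ?phiP //; apply: hC.
- move=> n _ [x hx ->]; apply: pows_ffun => i; apply: ideal_pow_smul_pows.
  by rewrite ffunE; apply: hx; apply: sI; apply: mem_nth.
- move=> n a _ ha [x hx ->]; exists (a *: x).
    move=> b bI; rewrite scalerA mulrC -scalerA.
    by apply: ideal_pow_smul_mul; [apply: sI|apply: hx].
  by rewrite -[a *: x]addr0 phiP phi0 addr0.
exists k => n kn x hx.
(* For $y\in(I^nN:_MI)$ and $a\in I$, $a\,\phi(y)=\phi(ay)$ with $ay\in I^nN$; hence sums over [s]
   fall into $\phi(I^nN)$. *)
pose X : set W := [set f | exists2 y, IN n y & f = phi y].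
have [y hy e] : X (phi x).
  have : L n.+1 (phi x) by exists x.
  move/(hk n kn); apply: (mulsum_sub (L' := X)).
    have [h0 h] := subIN n; split; first by exists 0.
    by move=> a _ _ [u hu ->] [v hv ->]; exists (a *: u + v); rewrite ?phiP //; apply: h.
  move=> a _ ha [y hy ->]; exists (a *: y); first by apply: hy; apply: sI.
  by rewrite -[a *: y]addr0 phiP phi0 addr0.
by exists y => //; apply: phi_eq0.
Qed.

End ArtinRees.

(** * Associated primes and the final comparison *)

(** The annihilator of the class of [x] is the colon $(L:x)$, so the quotient can be replaced by
    elements of [M]. *)
Lemma Ass_quotmod (R : comPzRingType) (M : lmodType R) (L : submodClosed M) :
  Ass (quotmod L) = [set p | prime_ideal p /\ exists x : M, p = [set a | a *: x \in L]].
Proof.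
pose q := \pi_(quotmod L)%qT : M -> quotmod L.
have q0 : q 0 = 0 by apply: (@addrI _ (q 0)); rewrite -quotmod_piD !addr0.
have qZ a x : a *: q x = q (a *: x) by apply: quotmod_pi_scale.
have annP (x : M) : ann (q x) = [set a | a *: x \in L].
  apply/seteqP; split=> a /=; rewrite /ann /= qZ -q0.
    by move/(quotmod_piP L (a *: x) 0); rewrite subr0.
  by move=> h; apply/(quotmod_piP L (a *: x) 0); rewrite subr0.
apply/seteqP; split=> p [pp [x e]]; split; rewrite // e.
- by exists (repr (x : quotmod L)); rewrite -annP /q reprK.
- by exists (q x); rewrite annP.
Qed.

Lemma Ass_subquot (R : comPzRingType) (M : lmodType R) (P L : submodClosed M) :
  Ass (subquot P L) = [set p | prime_ideal p /\
    exists2 x : M, x \in P & p = [set a | a *: x \in L]].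
Proof.
rewrite Ass_quotmod; apply/seteqP; split=> p [pp].
  by move=> [x e]; split; rewrite // e; exists (val x) => //; apply: submod_valP.
by move=> [x xP e]; split; rewrite // e; exists (SubmodOf xP).
Qed.

Lemma Ass_submod (R : comPzRingType) (M : lmodType R) (P : submodClosed M) :
  Ass (submod_of P) = [set p | prime_ideal p /\ exists2 x : M, x \in P & p = ann x].
Proof.
have annP (x : submod_of P) : ann x = ann (val x).
  apply/seteqP; split=> a /= h; first exact: (congr1 val h).
  by apply: val_inj; exact: h.
apply/seteqP; split=> p [pp].
  move=> [x e]; split; rewrite // e annP.
  by exists (val x) => //; apply: submod_valP.
by move=> [x xP e]; split; rewrite // e; exists (SubmodOf xP); rewrite // annP.
Qed.

(** If $u\in A\setminus p$, then $uv\in A\cap B=p$ for all $v\in B$, so $B\subseteq p$. This handles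
    the associated primes of a direct sum. *)
Lemma prime_ideal_eq_setI (R : comPzRingType) (p A B : set R) : prime_ideal p ->
  (forall a b, A a -> A (b * a)) -> (forall a b, B a -> B (b * a)) ->
  p = A `&` B -> p = A \/ p = B.
Proof.
move=> [_ _ _ _ pM] hA hB e.
have [pA|/existsNP[u /not_implyP[Au pu]]] := pselect (A `<=` p).
  by left; apply/seteqP; split=> // a; rewrite e => -[].
right; apply/seteqP; split=> [a|v Bv]; first by rewrite e => -[].
have : p (u * v) by rewrite e; split; [rewrite mulrC; apply: hA|apply: hB].
by case/pM.
Qed.

Theorem theorem2p2 (R : comPzRingType) (I : ideal R) (M : lmodType R)
    (N : submodClosed M) (noethR : noetherian R)
    (fgM : fg_module M) (fgN : fg_module (submod_of N)) :
  (exists n0 : nat, forall n : nat, (n0 <= n)%N ->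
     Ass (quot_pow I N n) `&` Vset I
     = Ass (submod_of (colon0 M I)) `|` Ass (gr_pow I N n))
  /\
  (forall A B : set (set R),
     stable_value (fun n => Ass (quot_pow I N n)) A ->
     stable_value (fun n => Ass (gr_pow I N n)) B ->
     A `&` Vset I = Ass (submod_of (colon0 M I)) `|` B).
Proof.
have part1 : exists n0 : nat, forall n : nat, (n0 <= n)%N ->
     Ass (quot_pow I N n) `&` Vset I
     = Ass (submod_of (colon0 M I)) `|` Ass (gr_pow I N n).
  have accM := fg_acc noethR fgM.
  have [s [sI genI]] := ideal_generators I noethR.
  have [k1 cap0] := colon0_cap_eventually0 N sI genI accM.
  have [k2 colonD] := colon_eventually N sI genI accM.
  (* The exponent becomes [n.+1], so that $I^nN$ plays the role of $I^{n-1}N$ and the bounds apply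
     to [n]. *)
  exists (maxn k1 k2).+1 => -[//|n]; rewrite ltnS geq_max => /andP[k1n k2n].
  have colonP x a : x \in colon0 M I -> a \in I -> a *: x = 0.
    by rewrite unfold_in => /asboolP; apply.
  rewrite Ass_quotmod Ass_submod Ass_subquot /=.
  apply/seteqP; split=> [p [[pp [x e]] [_ Ip]]|p].
    (* From $I\subseteq p$ follows $Ix\subseteq I^{n+1}N$, so $x=(x-y)+y$ with $x-y\in(0:_MI)$ and
       $y\in I^nN$. *)
    have [a aI|y hy hz] := colonD n k2n x.
      by have := Ip a aI; rewrite e.
    have e' : p = ann (x - y) `&` [set a | a *: y \in ideal_smul (ideal_pow I n.+1) N].
      rewrite e; apply/seteqP; split=> a /=.
        (* Directness of the sum: $a(x-y)\in I^nN\cap(0:_MI)=0$, as $ax\in I^{n+1}N\subseteq I^nN$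
           and $y\in I^nN$. *)
        move=> ax; have z0 : a *: (x - y) = 0.
          apply: (cap0 n k1n); last exact: rpredZ.
          rewrite /= scalerBr rpredB //; last exact: rpredZ.
          exact: ideal_pow_smul_succ_sub.
        by split=> //; rewrite -[y](subKr x) scalerBr z0 subr0.
      by move=> [z0 ay]; rewrite -[x](subrK y) scalerDr z0 add0r.
    have [||h|h] := prime_ideal_eq_setI pp _ _ e'.
    - by move=> a b; rewrite /ann /= -scalerA => ->; rewrite scaler0.
    - by move=> a b; rewrite /= -scalerA; apply: rpredZ.
    - by left; split=> //; exists (x - y).
    - by right; split=> //; exists y.
  case=> -[pp [x hx e]]; split.
  - split=> //; exists x; rewrite e; apply/seteqP; split=> a /= h.
      by rewrite h rpred0.
    (* For $x\in(0:_MI)$ with $ax\in I^{n+1}N$, the element $ax$ lies in the trivial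
       intersection. *)
    apply: (cap0 n.+1); [exact: leqW|exact: h|exact: rpredZ].
  - by split=> // a aI; rewrite e; apply: colonP.
  - by split=> //; exists x.
  - by split=> // a aI; rewrite e; apply: ideal_pow_smul_mul.
split=> // A B [nA hA] [nB hB]; have [n0 h] := part1.
(* At an exponent beyond all three thresholds, both stable values are attained and the equality
   holds. *)
pose n := maxn n0 (maxn nA nB).
have n0n : (n0 <= n)%N by apply: leq_maxl.
have nAn : (nA <= n)%N by rewrite /n !leq_max leqnn !orbT.
have nBn : (nB <= n)%N by rewrite /n !leq_max leqnn !orbT.
by rewrite -(hA n nAn) -(hB n nBn); apply: h.
Qed.
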